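(* Let $G=(V,E,A)$ be an acyclic mixed graph, let $\chi_G$ be its weak chromatic polynomial, and let $k$ be a positive integer. Then $(-1)^{|V|}\chi_G(-k)$ equals the number of $k$-colorings of $G$, each counted with multiplicity equal to the number of acyclic orientations of $G$ that are intercompatible with it.
   Context: A mixed graph $G=(V,E,A)$ consists of a finite set $V$ of vertices, a set $E$ of undirected edges (called edges, written $uv$) and a set $A$ of directed edges (called arcs, written $\vec{uv}$, directed from $u$ to $v$). Write $[k]:=\{1,2,\ldots,k\}$. A $k$-coloring of $G$ is any mapping $c:V\to[k]$ (not required to be proper). A weak proper $k$-coloring of $G$ is a $k$-coloring $c$ such that $c(u)\neq c(v)$ whenever $uv\in E$ and $c(u)\le c(v)$ whenever $\vec{uv}\in A$. The weak chromatic polynomial $\chi_G(k)$ is the number of weak proper $k$-colorings of $G$ for positive integers $k$; it is well known that this counting function is a polynomial in $k$, and $\chi_G(-k)$ denotes the value of this polynomial at $-k$. An orientation of $G$ is obtained by assigning a direction to each edge of $G$ (i.e. for each $uv\in E$ choosing either $u\to v$ or $v\to u$); the arcs of $G$ keep their given direction, and for an arc $\vec{uv}$ one also writes $u\to v$. An orientation is acyclic if it contains no directed cycle. A mixed graph is acyclic if all of its possible orientations are acyclic. A coloring $c$ and an orientation of $G$ are intercompatible if for every $u\to v$ in the orientation, $c(u)\le c(v)$ if $uv\in E$, and $c(u)<c(v)$ if $\vec{uv}\in A$. *)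

(* Defs.v *)
From mathcomp Require Import all_boot all_order all_algebra.
From mathcomp Require Import boolp.

Set Implicit Arguments.
Unset Strict Implicit.
Unset Printing Implicit Defensive.

Import GRing.Theory Num.Theory.

(* [edge] is symmetric because an undirected edge is an unordered pair.  Loops
   and parallel/opposite edges and arcs are not forbidden here. *)
Record mixedGraph (V : finType) := MixedGraph {
  edge : rel V;
  arc : rel V;
  edge_sym : symmetric edge
}.

Section MixedGraphs.
Variables (V : finType) (G : mixedGraph V).

(* The k colours are 0, ..., k - 1 instead of 1, ..., k; only their order
   matters. *)
Definition coloring (k : nat) := {ffun V -> 'I_k}.

Definition weak_proper k (c : coloring k) : bool :=
  [forall u, forall v,
     (edge G u v ==> (c u != c v)) && (arc G u v ==> (c u <= c v))].

Definition num_weak_proper (k : nat) : nat :=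
  #|[set c : coloring k | weak_proper c]|.

(* An orientation is given by the set O of ordered pairs (u, v) such that the
   edge uv is directed u -> v: exactly one of (u, v) and (v, u) is chosen for
   every edge uv.  Stating this with a cardinality makes it meaningful for a
   loop uu too, whose only direction is (u, u). *)
Definition is_orientation (O : {set V * V}) : bool :=
  [forall u, forall v,
     if edge G u v then #|O :&: [set (u, v); (v, u)]| == 1
     else (u, v) \notin O].

Definition directed (O : {set V * V}) : rel V :=
  [rel u v | ((u, v) \in O) || arc G u v].

(* [cycle r p] holds of p = [:: x_1; ...; x_n] when x_1 -> ... -> x_n -> x_1;
   it is also true of the empty sequence, which is not a directed cycle. *)
Definition acyclic_orientation (O : {set V * V}) : Prop :=
  forall p : seq V, path.cycle (directed O) p -> p = [::].

Definition acyclic_mixed_graph : Prop :=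
  forall O, is_orientation O -> acyclic_orientation O.

Definition intercompatible k (c : coloring k) (O : {set V * V}) : bool :=
  [forall u, forall v,
     (((u, v) \in O) ==> (c u <= c v)) && (arc G u v ==> (c u < c v))].

Definition multiplicity k (c : coloring k) : nat :=
  #|[set O : {set V * V} | [&& is_orientation O,
       `[< acyclic_orientation O >] & intercompatible c O]]|.

Local Open Scope ring_scope.

Definition is_weak_chromatic_poly (p : {poly rat}) : Prop :=
  forall k : nat, (0 < k)%N -> p.[k%:R] = (num_weak_proper k)%:R.

Lemma is_weak_chromatic_poly_unique p q :
  is_weak_chromatic_poly p -> is_weak_chromatic_poly q -> p = q.
Proof.
move=> hp hq; apply/eqP; rewrite -subr_eq0; apply/negPn/negP => nz.
pose s : seq rat := [seq i.+1%:R | i <- iota 0 (size (p - q))].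
have us : uniq s.
  rewrite map_inj_uniq ?iota_uniq // => i j /eqP.
  by rewrite eqr_nat eqSS => /eqP.
have rs : all (root (p - q)) s.
  by apply/allP => _ /mapP[i _ ->]; rewrite /root !hornerE hp // hq // subrr.
by have := max_poly_roots nz rs us; rewrite size_map size_iota ltnn.
Qed.

Definition color_set k (c : coloring k) : {set 'I_k} := [set c u | u in V].

Definition num_surj_weak_proper (m : nat) : nat :=
  #|[set c : coloring m | weak_proper c && (color_set c == setT)]|.

Lemma weak_proper_mono k m (f : 'I_k -> 'I_m) (c : coloring k) :
    {in color_set c &, {mono f : x y / (x <= y)%N}} ->
  weak_proper [ffun u => f (c u)] = weak_proper c.
Proof.
move=> mf; apply: eq_forallb => u; apply: eq_forallb => v.
have cu : c u \in color_set c by apply: imset_f.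
have cv : c v \in color_set c by apply: imset_f.
rewrite !ffunE mf //; congr (_ && _); congr (_ ==> _).
have finj : (f (c u) == f (c v)) = (c u == c v).
  apply/eqP/eqP => [e|-> //]; apply/val_inj/eqP; rewrite eqn_leq -!mf //.
  by rewrite e leqnn.
by rewrite finj.
Qed.

Lemma enum_val_mono k (S : {set 'I_k}) :
  forall i j : 'I_#|S|, (enum_val i <= enum_val j)%N = (i <= j)%N.
Proof.
have lt (i j : 'I_#|S|) : (i < j)%N -> (enum_val i < enum_val j)%N.
  move=> ij.
  have nthE (l : 'I_#|S|) :
      val (enum_val l) = nth 0%N [seq val x | x <- enum S] l.
    by rewrite (nth_map (enum_val l)) -?cardE // -enum_val_nth.
  rewrite !nthE.
  have so : sorted ltn [seq val x | x <- enum S].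
    apply: (@subseq_sorted _ ltn ltn_trans _ (iota 0 k)).
      by rewrite -val_enum_ord enumT /enum_mem map_subseq ?filter_subseq.
    exact: iota_ltn_sorted.
  by apply: (sorted_ltn_nth ltn_trans) => //; rewrite inE size_map -cardE.
move=> i j; case: (ltngtP i j) => [/lt/ltnW //|/lt|/val_inj -> //].
  by rewrite ltnNge => /negbTE.
by rewrite leqnn.
Qed.

Lemma card_color_set k (S : {set 'I_k}) :
  #|[set c : coloring k | weak_proper c && (color_set c == S)]| = num_surj_weak_proper #|S|.
Proof.
pose h (c : coloring #|S|) : coloring k := [ffun u => enum_val (c u)].
have hinj : injective h.
  move=> c d /ffunP e; apply/ffunP => u; move: (e u); rewrite !ffunE.
  exact: enum_val_inj.
rewrite /num_surj_weak_proper -(card_imset _ hinj); apply: eq_card => c.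
rewrite inE; apply/andP/imsetP => [[wc /eqP ic]|[d + ->]].
  have cS u : c u \in S by rewrite -ic; apply: imset_f.
  pose d : coloring #|S| := [ffun u => enum_rank_in (cS u) (c u)].
  have hd : c = h d by apply/ffunP => u; rewrite !ffunE enum_rankK_in.
  exists d => //; rewrite inE; apply/andP; split.
    have := @weak_proper_mono _ _ _ d (in2W (enum_val_mono (S := S))).
    by rewrite -/(h d) -hd wc => <-.
  rewrite eqEsubset subsetT; apply/subsetP => i _.
  have : enum_val i \in color_set c by rewrite ic enum_valP.
  case/imsetP => u _; rewrite hd ffunE => /enum_val_inj ->.
  exact: imset_f.
rewrite inE => /andP[wd /eqP id]; split.
  by rewrite (weak_proper_mono (in2W (enum_val_mono (S := S)))).
rewrite eqEsubset; apply/andP; split; apply/subsetP => x.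
  by case/imsetP => u _ ->; rewrite ffunE; apply: enum_valP.
move=> xS; have : enum_rank_in xS x \in color_set d by rewrite id inE.
case/imsetP => u _ e; apply/imsetP; exists u => //.
by rewrite ffunE -e enum_rankK_in.
Qed.

Lemma num_weak_proper_bin k :
  num_weak_proper k = (\sum_(m < #|V|.+1) 'C(k, m) * num_surj_weak_proper m)%N.
Proof.
rewrite /num_weak_proper -sum1_card.
rewrite (partition_big (@color_set k) predT) //=.
transitivity (\sum_(S : {set 'I_k}) num_surj_weak_proper #|S|)%N.
  apply: eq_bigr => S _; rewrite -card_color_set -sum1_card; apply: eq_bigl => c.
  by rewrite !inE.
have small m : (#|V| < m)%N -> num_surj_weak_proper m = 0%N.
  move=> Vm; apply/eqP; rewrite cards_eq0 -subset0; apply/subsetP => c.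
  rewrite inE => /andP[_ /eqP ic].
  by have := leq_imset_card c V; rewrite -/(color_set c) ic cardsT card_ord leqNgt Vm.
rewrite (bigID (fun S : {set 'I_k} => #|S| < #|V|.+1)%N) /= addnC big1 ?add0n.
  rewrite (partition_big (fun S : {set 'I_k} => inord #|S| : 'I_#|V|.+1) predT) //=.
  apply: eq_bigr => m _.
  rewrite -[X in 'C(X, _)](card_ord k) -card_draws -sum_nat_const.
  apply: eq_big => S.
    rewrite inE; apply/andP/eqP => [[Sm /eqP <-]|e]; first by rewrite inordK.
    by rewrite e ltn_ord inord_val.
  by case/andP => Sm /eqP <-; rewrite inordK.
by move=> S; rewrite -leqNgt => /small.
Qed.

Definition binomial_poly (m : nat) : {poly rat} := m`!%:R^-1 *: \prod_(i < m) ('X - i%:R%:P).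

Lemma binomial_polyE m k : (binomial_poly m).[k%:R] = 'C(k, m)%:R.
Proof.
have fz : (m`!%:R : rat) != 0 by rewrite pnatr_eq0 -lt0n fact_gt0.
apply: (mulfI fz); rewrite hornerZ mulrA divff // mul1r -natrM mulnC bin_ffact.
rewrite horner_prod; elim: m {fz} => [|m IH]; first by rewrite big_ord0 ffactn0.
rewrite big_ord_recr /= IH hornerXsubC ffactnSr natrM.
have [mk|km] := leqP m k; first by rewrite natrB.
by rewrite ffact_small // !mul0r.
Qed.

Lemma weak_chromatic_poly_exists : exists p, is_weak_chromatic_poly p.
Proof.
exists (\sum_(m < #|V|.+1) (num_surj_weak_proper m)%:R *: binomial_poly m) => k _.
rewrite num_weak_proper_bin horner_sum natr_sum; apply: eq_bigr => m _.
by rewrite hornerZ binomial_polyE natrM mulrC.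
Qed.

Definition weak_chromatic_poly : {poly rat} :=
  sval (cid weak_chromatic_poly_exists).

Lemma weak_chromatic_polyP : is_weak_chromatic_poly weak_chromatic_poly.
Proof. exact: svalP. Qed.

End MixedGraphs.

(* Main.v *)
Require Import Defs.
From mathcomp Require Import all_boot all_order all_algebra.
From mathcomp Require Import boolp.

(** A weak proper coloring of G increases strictly along exactly one
    orientation O, so the weak chromatic polynomial is the sum over all O of
    the polynomial counting the maps that are strict along O and weak along the
    arcs; on the other side, the colorings counted with multiplicity are the
    pairs of an orientation O and a map that is weak along O and strict along
    the arcs (here all orientations are acyclic).  It therefore suffices to
    prove, for each O, a reciprocity between the maps V -> [k] that are strict
    along S := O and weak along W := arcs, and those with S and W exchanged
    ([order_poly_reciprocity]).  This is Stanley's reciprocity for labelled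
    posets; what it requires is that W together with the reverse of S be
    acyclic, and that holds because the reverse of O is an orientation too.

    Both families are counted by peeling off the colour classes from the top.
    Write N(k, X) for the number of maps X -> [k] and call U a top layer of X
    if it can be the class of the largest colour; then
      N(k + 1, X) = sum over the top layers U of X of N(k, X \ U).
    Thus N(k, -) is the k-th power of a unipotent operator A on functions of
    subsets, applied to the indicator of the empty set; such a power is a
    polynomial in k ([flag_polyE]) whose value at -k is given by the k-th power
    of the inverse of A ([flag_poly_step]).  Let B be the operator for the
    exchanged roles and D the diagonal matrix of the signs (-1)^|X|.  The claim
    is then B = D A^-1 D.  Expanding A D B D, the coefficient at X \ T is a sum
    of (-1)^|U| over the ways of splitting T into a top layer U for (S, W)
    followed by one, T \ U, for (W, S).  If T is not empty, acyclicity provides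
    a v in T that is not the tail of an S-arrow and not the head of a W-arrow
    inside T; moving v between the two parts preserves their
    conditions and flips the sign, so that the sum vanishes
    ([top_layer_inverse]). *)

Set Implicit Arguments.
Unset Strict Implicit.
Unset Printing Implicit Defensive.

Import GRing.Theory Num.Theory.
Local Open Scope ring_scope.

(** * Sources and sign-reversing toggles *)

(** An element of T with the fewest r-ancestors has no r-predecessor in T: such
    a predecessor would have strictly fewer, as v itself is not among them. *)
Lemma acyclic_source (V : finType) (r : rel V) (T : {set V}) :
  (forall p : seq V, path.cycle r p -> p = [::]) -> T != set0 ->
  exists2 v, v \in T & forall x, x \in T -> ~~ r x v.
Proof.
move=> acr /set0Pn[v0 v0T].
pose below v := [set x | connect r x v].
case: (arg_minnP (fun v => #|below v|) v0T) => v vT minv.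
exists v => // x xT; apply/negP => rxv.
have /negP[] : ~~ (#|below x| < #|below v|)%N by rewrite -leqNgt minv.
apply/proper_card/properP; split.
  apply/subsetP => y; rewrite !inE => /connect_trans; apply; exact: connect1.
exists v; rewrite !inE //; apply/negP => /connectP[p vp xE].
by have /acr : path.cycle r (v :: p) by rewrite /= rcons_path vp -xE.
Qed.

Section SignedToggle.
Variables (V : finType) (v : V).

Definition toggle (U : {set V}) := if v \in U then U :\ v else v |: U.

Lemma in_toggle U x : (x \in toggle U) = (x == v) (+) (x \in U).
Proof.
rewrite /toggle; case: ifP => vU; rewrite !inE; case: eqVneq => //= ->.
  by rewrite vU.
by rewrite vU.
Qed.

Lemma toggleK : involutive toggle.
Proof. by move=> U; apply/setP => x; rewrite !in_toggle addbA addbb. Qed.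

Lemma sign_toggle U : (-1) ^+ #|toggle U| = - (-1) ^+ #|U| :> rat.
Proof.
rewrite /toggle; case: ifP => vU.
  by rewrite [in RHS](cardsD1 v) vU exprS mulN1r opprK.
by rewrite cardsU1 vU exprS mulN1r.
Qed.

Lemma sum_sign_toggle (P : pred {set V}) :
  (forall U, P (toggle U) = P U) -> \sum_(U | P U) (-1) ^+ #|U| = 0 :> rat.
Proof.
move=> Pt; set s := LHS.
have sN : s = - s.
  rewrite {1}/s (reindex_inj (inv_inj toggleK)) -sumrN.
  by apply: eq_big => U; rewrite ?Pt ?sign_toggle.
by apply/eqP; rewrite -[_ == _]orFb -(mulrn_eq0 s 2) mulr2n {2}sN subrr.
Qed.

End SignedToggle.

(** * Chains of sets counted by polynomials *)

Lemma binomial_poly_pascal m (x : rat) :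
  (binomial_poly m.+1).[x + 1] =
  (binomial_poly m.+1).[x] + (binomial_poly m).[x].
Proof.
have fz j : (j`!%:R : rat) != 0 by rewrite pnatr_eq0 -lt0n fact_gt0.
rewrite /binomial_poly !hornerZ.
apply: (mulfI (fz m.+1)); rewrite mulrDr !mulrA divff // !mul1r factS natrM.
rewrite mulfK // !horner_prod big_ord_recl big_ord_recr /=.
under [X in _ * X = _]eq_bigr => i _.
  rewrite hornerXsubC /bump /= -[(1 + i)%N]addn1 natrD opprD addrACA subrr addr0.
  over.
under [X in _ = X * _ + _]eq_bigr => i _ do rewrite hornerXsubC.
under [X in _ = _ + _ * X]eq_bigr => i _ do rewrite hornerXsubC.
rewrite !hornerXsubC subr0 [X in _ = X + _]mulrC -mulrDl; congr (_ * _).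
by rewrite -natr1 addrA subrK.
Qed.

Lemma binomial_poly_at0 m : (binomial_poly m).[0] = (m == 0%N)%:R.
Proof. by rewrite -[0]/(0%:R) binomial_polyE bin0n. Qed.

Section Layers.
(* layer X U is to be read: U may be removed from X in one step. *)
Variables (V : finType) (layer : {set V} -> {set V} -> bool).
Implicit Types (X U : {set V}).

(** The number of chains from X down to the empty set in k steps, each of which
    removes a (possibly empty) layer: the entry of A^k at X and the empty set,
    for the operator A attached to the relation layer. *)
Fixpoint flags k (X : {set V}) : nat :=
  if k is k'.+1 then (\sum_(U | layer X U) flags k' (X :\: U))%N else X == set0.

(** The same for A - 1, whose steps are all strict. *)
Fixpoint proper_flags k (X : {set V}) : nat :=
  if k is k'.+1
  then (\sum_(U | layer X U && (U != set0)) proper_flags k' (X :\: U))%N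
  else X == set0.

(** The binomial expansion of A^x = (1 + (A - 1))^x, which is finite because
    A - 1 is nilpotent. *)
Definition flag_poly X : {poly rat} :=
  \sum_(m < #|V|.+1) (proper_flags m X)%:R *: binomial_poly m.

Hypothesis layer0 : forall X, layer X set0.
Hypothesis layer_sub : forall X U, layer X U -> U \subset X.

Lemma proper_flags_small m X : (#|X| < m)%N -> proper_flags m X = 0%N.
Proof.
elim: m X => // m IH X Xm /=; apply: big1 => U /andP[/layer_sub UX U0].
apply: IH; rewrite ltnS in Xm; apply: leq_trans Xm.
rewrite cardsD (setIidPr UX) -subn_gt0 subKn ?subset_leq_card //.
by rewrite card_gt0.
Qed.

(** The recursion A^(x+1) = A A^x, for every rational x; at negative integers it
    determines the values of the polynomial by going backwards. *)
Lemma flag_poly_step X x :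
  (flag_poly X).[x + 1] = \sum_(U | layer X U) (flag_poly (X :\: U)).[x].
Proof.
have polyE Y y : (flag_poly Y).[y] =
    \sum_(m < #|V|.+1) (proper_flags m Y)%:R * (binomial_poly m).[y].
  by rewrite horner_sum; apply: eq_bigr => m _; rewrite hornerZ.
have tail : \sum_(U | layer X U && (U != set0)) (flag_poly (X :\: U)).[x] =
    \sum_(m < #|V|) (proper_flags m.+1 X)%:R * (binomial_poly m).[x].
  transitivity
    (\sum_(m < #|V|.+1) (proper_flags m.+1 X)%:R * (binomial_poly m).[x]).
    under eq_bigr => U _ do rewrite polyE.
    rewrite exchange_big; apply: eq_bigr => m _ /=.
    by rewrite natr_sum mulr_suml.
  by rewrite big_ord_recr proper_flags_small ?ltnS ?max_card // mul0r /= addr0.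
rewrite (bigD1 set0) //= setD0 tail !polyE !big_ord_recl -addrA.
congr (_ + _).
  by congr (_ * _); rewrite /binomial_poly big_ord0 !hornerE.
rewrite -big_split; apply: eq_bigr => m _ /=.
by rewrite -mulrDr -binomial_poly_pascal.
Qed.

Lemma flag_poly_at0 X : (flag_poly X).[0] = (X == set0)%:R.
Proof.
rewrite horner_sum big_ord_recl hornerZ binomial_poly_at0 mulr1 big1 ?addr0 //.
by move=> m _; rewrite hornerZ binomial_poly_at0 mulr0.
Qed.

Lemma flag_polyE k X : (flag_poly X).[k%:R] = (flags k X)%:R.
Proof.
elim: k X => [|k IH] X; first exact: flag_poly_at0.
rewrite -natr1 flag_poly_step natr_sum.
by apply: eq_bigr => U _; rewrite IH.
Qed.

End Layers.

(** * Reciprocity for inverse layer relations *)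

Section Reciprocity.
Variables (V : finType) (layer layer' : {set V} -> {set V} -> bool).
Implicit Types (X U T : {set V}).
Hypothesis layer0 : forall X, layer X set0.
Hypothesis layer_sub : forall X U, layer X U -> U \subset X.
Hypothesis layer'0 : forall X, layer' X set0.
Hypothesis layer'_sub : forall X U, layer' X U -> U \subset X.
(* With A, B the operators of layer, layer' and D the diagonal of signs, the
   off-diagonal entries of A D B D vanish. *)
Hypothesis layer_inverse : forall X T : {set V}, T \subset X -> T != set0 ->
  \sum_(U : {set V} | [&& U \subset T, layer X U & layer' (X :\: U) (T :\: U)])
     (-1) ^+ #|U| = 0 :> rat.

(** A D B D = 1 turned into a recursion: the pairs of successive layers U, U' are
    grouped by their union T, and only the empty T survives. *)
Lemma flags_inverse k X :
  \sum_(U | layer X U) (-1) ^+ #|U| * (flags layer' k.+1 (X :\: U))%:R =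
  (flags layer' k X)%:R :> rat.
Proof.
pose good (U T : {set V}) :=
  [&& U \subset T, layer X U & layer' (X :\: U) (T :\: U)].
transitivity (\sum_(U | layer X U) \sum_(T | good U T)
    (-1) ^+ #|U| * (flags layer' k (X :\: T))%:R : rat).
  apply: eq_bigr => U LU; rewrite natr_sum mulr_sumr.
  rewrite (reindex_onto (fun T => T :\: U) (fun U' => U :|: U')) /=; last first.
    move=> U' /layer'_sub; rewrite subsetD => /andP[_ dU].
    by rewrite setDUl setDv set0U; apply/setDidPl.
  have UDE T : U :|: T :\: U = U :|: T.
    by apply/setP => x; rewrite !inE; case: (x \in U).
  rewrite /good LU /=; apply: eq_big => T.
    by rewrite UDE (sameP eqP setUidPr) andbC.
  rewrite UDE => /andP[_ /eqP UT].
  by rewrite setDDl UDE UT.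
rewrite (exchange_big_dep (fun T => T \subset X)) /=; last first.
  move=> U T LU /and3P[UT _ /layer'_sub]; rewrite subsetD subDset => /andP[TX _].
  by rewrite (setUidPr (layer_sub LU)) in TX.
rewrite (bigD1 set0) ?sub0set //= [X in _ + X]big1 ?addr0.
  rewrite (big_pred1 set0) ?cards0 ?mul1r ?setD0 // => U.
  rewrite /good subset0 /=; case: eqP => [->|]; last by rewrite andbF.
  by rewrite layer0 !setD0 layer'0.
move=> T /andP[TX T0]; rewrite -mulr_suml.
rewrite [X in X * _](_ : _ = 0) ?mul0r // -[RHS](layer_inverse TX T0).
by apply: eq_bigl => U; rewrite /good; case: (layer X U); rewrite ?andbF.
Qed.

(** Both sides satisfy the recursion of [flags_inverse], in which the term of the
    empty layer has coefficient 1 and the other terms concern smaller sets. *)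
Lemma flag_poly_reciprocity k X :
  (-1) ^+ #|X| * (flag_poly layer X).[- k%:R] = (flags layer' k X)%:R.
Proof.
elim: k X => [|k IHk] X.
  rewrite oppr0 flag_poly_at0 /=; case: eqP => [->|_]; last by rewrite mulr0.
  by rewrite cards0 mul1r.
move: {2}#|X|.+1 (ltnSn #|X|) => n; elim: n X => // n IHn X Xn.
have := flags_inverse k X; rewrite -IHk -[- k%:R](subrK 1) -opprD natr1.
rewrite flag_poly_step // mulr_sumr.
rewrite (bigD1 set0) //= [in RHS](bigD1 set0) //= !setD0 cards0 mul1r.
rewrite [X in _ + X = _](_ : _ = \sum_(U | layer X U && (U != set0))
    (-1) ^+ #|X| * (flag_poly layer (X :\: U)).[- k.+1%:R]).
  by move/addIr.
apply: eq_bigr => U /andP[/layer_sub UX U0].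
have Ulex := subset_leq_card UX.
rewrite -IHn.
  rewrite mulrA -exprD cardsD (setIidPr UX) subnKC //.
rewrite cardsD (setIidPr UX); apply: leq_trans (Xn : #|X| <= n)%N.
by rewrite -subn_gt0 subKn // card_gt0.
Qed.

End Reciprocity.

(** * Maps with strict and weak inequalities *)

Section OrderLayers.
Variables (V : finType).
Implicit Types (S W : rel V) (X U T : {set V}).

(** The possible classes of the largest colour in a map on X that is strict along
    S and weak along W. *)
Definition top_layer S W X U :=
  (U \subset X) &&
  [forall u in U, forall v in X, ~~ S u v && (W u v ==> (v \in U))].

Lemma top_layerP S W X U :
  reflect (U \subset X /\ forall u v, u \in U -> v \in X ->
             ~~ S u v /\ (W u v -> v \in U))
          (top_layer S W X U).
Proof.
apply: (iffP andP) => -[UX H]; split=> //.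
  move=> u v uU vX; move/forall_inP: H => /(_ u uU)/forall_inP/(_ v vX).
  by case/andP => nS /implyP.
apply/forall_inP => u uU; apply/forall_inP => v vX.
by have [nS H'] := H u v uU vX; rewrite nS; apply/implyP.
Qed.

Lemma top_layer0 S W X : top_layer S W X set0.
Proof. by apply/top_layerP; split=> [|u v]; rewrite ?sub0set ?inE. Qed.

Lemma top_layer_sub S W X U : top_layer S W X U -> U \subset X.
Proof. by case/andP. Qed.

(** For a fixed union T, the conditions on a pair of successive layers, the first
    for (S, W) and the second for (W, S), constrain the elements of T one by
    one: this is what makes toggling a single element possible. *)
Lemma two_layersP S W X U T : T \subset X ->
  reflect (U \subset T /\ forall u v, u \in T -> v \in X ->
             (S u v -> v \in T /\ u \notin U) /\ (W u v -> v \in U))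
    [&& U \subset T, top_layer S W X U & top_layer W S (X :\: U) (T :\: U)].
Proof.
move=> TX; apply: (iffP and3P) => [[UT /top_layerP[UX H] /top_layerP[_ H']]|[UT H]].
  split=> // u v uT vX; have [uU|uU] := boolP (u \in U).
    have [nS HW] := H u v uU vX; split=> // Suv; by rewrite Suv in nS.
  have [vU|vU] := boolP (v \in U); first by rewrite (subsetP UT _ vU).
  have [||nW HS] := H' u v; rewrite ?inE ?uT ?uU ?vU //.
  split; last by move=> Wuv; rewrite Wuv in nW.
  by move/HS; rewrite inE => /andP[].
split=> //; apply/top_layerP; split.
- exact: subset_trans UT TX.
- move=> u v uU vX; have [HS HW] := H u v (subsetP UT _ uU) vX; split=> //.
  by apply/negP => /HS[_]; rewrite uU.
- exact: setSD.
move=> u v; rewrite !inE => /andP[uU uT] /andP[vU vX].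
have [HS HW] := H u v uT vX; split; first by apply: contra vU.
by case/HS => ->; rewrite vU.
Qed.

(** An element v of T that no S-arrow leaves and no W-arrow enters within T can
    be moved freely between the two layers, so the signs cancel in pairs. *)
Lemma top_layer_inverse S W X T :
    (forall p, path.cycle [rel u v | S v u || W u v] p -> p = [::]) ->
    T \subset X -> T != set0 ->
  \sum_(U : {set V} | [&& U \subset T, top_layer S W X U
             & top_layer W S (X :\: U) (T :\: U)]) (-1) ^+ #|U| = 0 :> rat.
Proof.
move=> acy TX T0; have [v vT src] := acyclic_source acy T0.
apply: (@sum_sign_toggle _ v).
suff imp U : [&& U \subset T, top_layer S W X U
                 & top_layer W S (X :\: U) (T :\: U)] ->
    [&& toggle v U \subset T, top_layer S W X (toggle v U)
      & top_layer W S (X :\: toggle v U) (T :\: toggle v U)].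
  by move=> U; apply/idP/idP => /imp; rewrite ?toggleK.
case/(two_layersP S W U TX) => UT H; apply/(two_layersP S W _ TX); split.
  apply/subsetP => x; rewrite in_toggle; case: eqVneq => [-> //|_ /=].
  exact: (subsetP UT).
move=> x y xT yX; have [HS HW] := H x y xT yX; rewrite !in_toggle; split.
  move=> Sxy; have [yT xU] := HS Sxy; split=> //.
  have /negP := src y yT; case: eqVneq => [<- /=|_ _ //].
  by rewrite Sxy.
move=> Wxy; rewrite (HW Wxy) addbT; apply/eqP => yv.
by have /negP := src x xT; rewrite -yv /= Wxy orbT.
Qed.

Definition order_maps S W k : {set {ffun V -> 'I_k}} :=
  [set c : {ffun V -> 'I_k} |
    [forall u, forall v,
       (S u v ==> (c u < c v)%N) && (W u v ==> (c u <= c v)%N)]].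

(** The maps from X to the k smallest colours, extended by the colour 0 outside X
    so that all X and k share one type of functions. *)
Definition partial_map S W n k X (c : {ffun V -> 'I_n.+1}) :=
  [forall v, if v \in X then (c v < k)%N else c v == ord0] &&
  [forall u in X, forall v in X,
     (S u v ==> (c u < c v)%N) && (W u v ==> (c u <= c v)%N)].

Lemma partial_mapP S W n k X (c : {ffun V -> 'I_n.+1}) :
  reflect [/\ forall v, v \in X -> (c v < k)%N,
              forall v, v \notin X -> c v = ord0
            & forall u v, u \in X -> v \in X ->
                (S u v -> c u < c v)%N /\ (W u v -> c u <= c v)%N]
          (partial_map S W k X c).
Proof.
apply: (iffP andP) => [[/forallP H1 /forall_inP H2]|[H1 H2 H3]].
  split=> [v vX|v vX|u v uX vX].
  - by have := H1 v; rewrite vX.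
  - by have := H1 v; rewrite (negbTE vX) => /eqP.
  - by have /forall_inP/(_ v vX)/andP[/implyP ? /implyP ?] := H2 u uX.
split; first by apply/forallP => v; case: ifPn => [/H1|/H2/eqP].
apply/forall_inP => u uX; apply/forall_inP => v vX.
by have [? ?] := H3 u v uX vX; apply/andP; split; apply/implyP.
Qed.

(** Erasing the top colour class, i.e. recolouring it with the filler 0, leaves a
    partial map on the rest; painting the class with the colour k undoes it. *)
Lemma card_partial_map S W n k X : (k <= n.+1)%N ->
  #|[set c | @partial_map S W n k X c]| = flags (top_layer S W) k X.
Proof.
elim: k X => [|k IH] X kn /=.
  have [->|/set0Pn[x xX]] := eqVneq X set0.
    apply/eqP/cards1P; exists [ffun=> ord0]; apply/setP => c; rewrite !inE.
    apply/partial_mapP/eqP => [[_ c0 _]|->].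
      by apply/ffunP => v; rewrite ffunE c0 ?inE.
    by split=> [v|v _|u v]; rewrite ?inE ?ffunE.
  apply: eq_card0 => c; rewrite inE; apply/negP => /partial_mapP[/(_ x xX)].
  by rewrite ltn0.
pose top (c : {ffun V -> 'I_n.+1}) := [set v in X | c v == k :> nat].
rewrite -sum1_card (partition_big top (top_layer S W X)); last first.
  move=> c; rewrite inE => /partial_mapP[Hk _ H]; apply/top_layerP; split.
    by apply/subsetP => v; rewrite inE => /andP[].
  move=> u v; rewrite !inE => /andP[uX /eqP cu] vX.
  have [HS HW] := H u v uX vX; have := Hk v vX; rewrite ltnS => cv; split.
    by apply/negP => /HS; rewrite cu ltnNge cv.
  by move/HW; rewrite cu vX eqn_leq cv.
apply: eq_bigr => U /top_layerP[UX HU]; rewrite -(IH _ (ltnW kn)) -sum1_card.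
pose erase (c : {ffun V -> 'I_n.+1}) := [ffun v => if v \in U then ord0 else c v].
pose paint (c : {ffun V -> 'I_n.+1}) :=
  [ffun v => if v \in U then inord k else c v].
have paintE c v : paint c v = (if v \in U then k else c v) :> nat.
  by rewrite ffunE; case: ifP => // _; rewrite inordK.
rewrite (reindex_onto paint erase) /=; last first.
  move=> c /andP[_ /eqP topc]; apply/ffunP => v; apply: val_inj.
  rewrite /= paintE ffunE; case: ifP => [|-> //].
  by rewrite -topc inE => /andP[_ /eqP].
apply: eq_bigl => c; rewrite !inE; apply/andP/partial_mapP.
  case=> /andP[/partial_mapP[Hk H0 H] /eqP topc] /eqP erasec; split.
  - move=> v; rewrite inE => /andP[vU vX].
    have := Hk v vX; rewrite paintE (negbTE vU) ltnS leq_eqVlt.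
    case: eqP => // cvk _; case/negP: vU.
    by rewrite -topc inE vX paintE cvk if_same eqxx.
  - move=> v; rewrite inE negb_and negbK => /orP[vU|vX].
      by rewrite -erasec ffunE vU.
    have vU : v \notin U by apply: contra vX; apply: (subsetP UX).
    by have := H0 v vX; rewrite ffunE (negbTE vU).
  - move=> u v; rewrite !inE => /andP[uU uX] /andP[vU vX].
    by have := H u v uX vX; rewrite !paintE (negbTE uU) (negbTE vU).
case=> Hk H0 H.
have Hk' v : v \in X -> v \notin U -> (c v < k)%N.
  by move=> vX vU; apply: Hk; rewrite inE vU.
split; last first.
  apply/eqP/ffunP => v; rewrite !ffunE; case: ifP => [vU|-> //].
  by rewrite H0 // inE vU.
apply/andP; split; last first.
  apply/eqP/setP => v; rewrite inE paintE; case: ifPn => vU.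
    by rewrite (subsetP UX _ vU) eqxx.
  by apply/andP => -[vX /eqP cv]; have := Hk' v vX vU; rewrite cv ltnn.
apply/partial_mapP; split=> [v vX|v vX|u v uX vX].
- by rewrite paintE ltnS; case: ifPn => // vU; apply/ltnW/Hk'.
- have vU : v \notin U by apply: contra vX; apply: (subsetP UX).
  by rewrite ffunE (negbTE vU) H0 // inE (negbTE vX) andbF.
rewrite !paintE; case: ifPn => uU.
  have [nS HW] := HU u v uU vX; split=> [Suv|/HW -> //].
  by rewrite Suv in nS.
have cu := Hk' u uX uU; case: ifPn => vU; first by split=> // _; exact: ltnW.
by apply: H; rewrite inE ?uU ?vU.
Qed.

Lemma card_order_maps S W k : (0 < k)%N ->
  #|order_maps S W k| = flags (top_layer S W) k setT.
Proof.
case: k => // n _; rewrite -(card_partial_map S W setT (leqnn n.+1)).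
apply: eq_card => c; rewrite !inE; apply/forallP/partial_mapP.
  move=> H; split=> [v _|v|u v _ _]; rewrite ?inE //.
  by have /forallP/(_ v)/andP[/implyP ? /implyP ?] := H u.
case=> _ _ H u; apply/forallP => v.
by have [? ?] := H u v (in_setT u) (in_setT v); apply/andP; split; apply/implyP.
Qed.

Definition order_poly S W := flag_poly (top_layer S W) setT.

Lemma order_polyE S W k : (0 < k)%N ->
  (order_poly S W).[k%:R] = #|order_maps S W k|%:R.
Proof.
move=> k0; rewrite card_order_maps //; apply: flag_polyE.
  exact: top_layer0.
exact: top_layer_sub.
Qed.

(** Reversing S in the hypothesis expresses that the strict and weak inequalities
    come from a labelling of V (strict along descents of the labels, weak along
    ascents). The result fails without it, for example if S has the arrows
    a -> b -> c and W has a -> c. *)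
Lemma order_poly_reciprocity S W k :
    (forall p, path.cycle [rel u v | S v u || W u v] p -> p = [::]) ->
  (0 < k)%N ->
  (-1) ^+ #|V| * (order_poly S W).[- k%:R] = #|order_maps W S k|%:R.
Proof.
move=> acy k0; rewrite card_order_maps // -cardsT.
apply: flag_poly_reciprocity => [X|X U|X|X U|X T].
- exact: top_layer0.
- by move/top_layer_sub.
- exact: top_layer0.
- by move/top_layer_sub.
- exact: top_layer_inverse.
Qed.

End OrderLayers.

(** * Orientations of a mixed graph *)

Section Orientations.
Variables (V : finType) (G : mixedGraph V).
Implicit Types (O : {set V * V}).

Definition edge_dir O : rel V := [rel u v | (u, v) \in O].
Definition reverse O := [set p : V * V | (p.2, p.1) \in O].

Lemma orientation_edge O u v : is_orientation G O -> (u, v) \in O -> edge G u v.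
Proof.
by move=> /forallP/(_ u)/forallP/(_ v); case: ifP => // _ /negbTE->.
Qed.

Lemma reverse_orientation O : is_orientation G O -> is_orientation G (reverse O).
Proof.
move=> /forallP H; apply/forallP => u; apply/forallP => v.
have /forallP/(_ u) := H v; rewrite edge_sym inE /=; case: ifP => // _ /eqP <-.
have swK : injective (fun p : V * V => (p.2, p.1)) by case=> a b [] c d [-> ->].
rewrite -(card_imset _ swK); apply/eqP/eq_card => -[a b].
apply/imsetP/idP => [[[x y] + [-> ->]]|].
  by rewrite !inE /= !xpair_eqE => /andP[->]; rewrite andbC [_ && (y == u)]andbC.
rewrite !inE => H'; exists (b, a) => //; rewrite !inE /=; move: H'.
by rewrite !xpair_eqE => /andP[->]; rewrite andbC [_ && (a == u)]andbC.
Qed.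

Lemma orientation_total O u v :
  is_orientation G O -> edge G u v -> ((u, v) \in O) || ((v, u) \in O).
Proof.
move=> /forallP/(_ u)/forallP/(_ v) + uv; rewrite uv => /cards1P[p Op].
have : p \in O :&: [set (u, v); (v, u)] by rewrite Op inE.
by rewrite !inE => /andP[pO /orP[/eqP <-|/eqP <-]]; rewrite pO ?orbT.
Qed.

(** A weak proper coloring determines its orientation: each edge points to its
    end of larger colour. Conversely, strictness along the edges makes the
    coloring proper. *)
Lemma card_compatible_orientations k (c : coloring V k) :
  #|[set O | is_orientation G O && (c \in order_maps (edge_dir O) (Defs.arc G) k)]| =
  weak_proper G c.
Proof.
pose Oc := [set p : V * V | edge G p.1 p.2 && (c p.1 < c p.2)%N].
have compatP O : reflect (forall u v, ((u, v) \in O -> c u < c v)%N /\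
                                      (Defs.arc G u v -> c u <= c v)%N)
                         (c \in order_maps (edge_dir O) (Defs.arc G) k).
  rewrite inE; apply: (iffP forallP) => H u.
    by move=> v; have /forallP/(_ v)/andP[/implyP ? /implyP ?] := H u.
  by apply/forallP => v; have [? ?] := H u v; apply/andP; split; apply/implyP.
case: (boolP (weak_proper G c)) => [wc|nwc].
  have wcP u v : (edge G u v -> c u != c v) /\ (Defs.arc G u v -> c u <= c v)%N.
    by have /forallP/(_ u)/forallP/(_ v)/andP[/implyP ? /implyP ?] := wc.
  apply/eqP/cards1P; exists Oc; apply/setP => O; rewrite !in_set1 inE.
  apply/andP/eqP => [[oO /compatP H]|->].
    apply/setP => -[u v]; rewrite inE /=; apply/idP/andP => [uvO|[uv cuv]].
      by split; [exact: orientation_edge uvO | have [/(_ uvO)] := H u v].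
    case/orP: (orientation_total oO uv) => // vuO.
    by have [/(_ vuO)] := H v u; rewrite ltnNge ltnW.
  split; last first.
    apply/compatP => u v; split; last by have [] := wcP u v.
    by rewrite inE => /andP[].
  apply/forallP => u; apply/forallP => v; rewrite !inE /=.
  case: ifPn => uv; last by rewrite (negbTE uv).
  have [/(_ uv) + _] := wcP u v.
  rewrite -(inj_eq val_inj) neq_ltn => /orP[] lt; apply/cards1P.
    exists (u, v); apply/setP => -[x y]; rewrite !inE /= !xpair_eqE.
    apply/andP/andP => [[/andP[_ xy] /orP[/andP[]|/andP[/eqP xv /eqP yu]]] //|].
      by rewrite xv yu ltnNge ltnW in xy.
    by case=> /eqP -> /eqP ->; rewrite uv lt !eqxx.
  exists (v, u); apply/setP => -[x y]; rewrite !inE /= !xpair_eqE.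
  apply/andP/andP => [[/andP[_ xy] /orP[/andP[/eqP xu /eqP yv]|/andP[]]] //|].
    by rewrite xu yv ltnNge ltnW in xy.
  by case=> /eqP -> /eqP ->; rewrite edge_sym uv lt !eqxx orbT.
apply: eq_card0 => O; rewrite inE; apply/negP => /andP[oO /compatP H].
case/negP: nwc; apply/forallP => u; apply/forallP => v.
apply/andP; split; apply/implyP; last by have [] := H u v.
move=> uv; rewrite -(inj_eq val_inj) neq_ltn.
case/orP: (orientation_total oO uv) => O_; first by have [-> //] := H u v.
by have [-> //] := H v u; rewrite orbT.
Qed.

Lemma weak_chromatic_poly_sum :
  weak_chromatic_poly G =
  \sum_(O | is_orientation G O) order_poly (edge_dir O) (Defs.arc G).
Proof.
apply: (is_weak_chromatic_poly_unique (weak_chromatic_polyP G)) => k k0.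
rewrite horner_sum; under eq_bigr => O _ do rewrite order_polyE // -sum1_card.
rewrite -natr_sum (exchange_big_dep predT) //=; congr _%:R.
rewrite /num_weak_proper -sum1_card [RHS]big_mkcond; apply: eq_bigr => c _.
rewrite inE (_ : (if _ then _ else _) = weak_proper G c :> nat); last by case: ifP.
by rewrite -card_compatible_orientations -sum1_card; apply: eq_bigl => O; rewrite inE.
Qed.

(** The relation is that of the orientation opposite to O: the edges are turned
    around but not the arcs. *)
Lemma reversed_edges_acyclic O : acyclic_mixed_graph G -> is_orientation G O ->
  forall p, path.cycle [rel u v | edge_dir O v u || Defs.arc G u v] p -> p = [::].
Proof.
move=> hG /reverse_orientation/hG H p.
rewrite (@eq_cycle _ _ (directed G (reverse O))); first exact: H.
by move=> u v; rewrite /directed /reverse /= inE.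
Qed.

Lemma sum_multiplicity k : acyclic_mixed_graph G ->
  (\sum_(c : coloring V k) multiplicity G c =
   \sum_(O | is_orientation G O) #|order_maps (Defs.arc G) (edge_dir O) k|)%N.
Proof.
move=> hG; under [RHS]eq_bigr => O _ do rewrite -sum1_card.
rewrite (exchange_big_dep predT) //=; apply: eq_bigr => c _.
rewrite /multiplicity -sum1_card; apply: eq_bigl => O; rewrite !inE.
case oO: (is_orientation G O) => //=; rewrite (asboolT (hG O oO)) /=.
by apply: eq_forallb => u; apply: eq_forallb => v; rewrite andbC.
Qed.

End Orientations.

Theorem theorem2 (V : finType) (G : mixedGraph V) (k : nat)
    (hG : acyclic_mixed_graph G) (hk : (0 < k)%N) :
  (-1) ^+ #|V| * (weak_chromatic_poly G).[- k%:R]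
  = (\sum_(c : coloring V k) multiplicity G c)%:R :> rat.
Proof.
rewrite sum_multiplicity // weak_chromatic_poly_sum horner_sum mulr_sumr natr_sum.
apply: eq_bigr => O oO; apply: order_poly_reciprocity => //.
exact: reversed_edges_acyclic.
Qed.
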